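(* Let $\Gamma\cup\{\varphi\}\subseteq\mathcal{L}$. Then $\Gamma\vdash\varphi$ (in $\mathbf{mb}^\bigstar$) implies $\Gamma\models\varphi$.
   Context: Let $V$ be a denumerable set of propositional variables and let $\mathcal{L}$ be the set of formulas generated freely from $V$ by the binary connectives $\land,\lor,\longrightarrow$ and the unary connectives $\neg,\bigstar$. The logic $\mathbf{mb}^\bigstar=\langle\mathcal{L},\vdash\rangle$ is given by the Hilbert-style system with the following axiom schemas (for all $\alpha,\beta,\gamma\in\mathcal{L}$): (1) $\alpha\longrightarrow(\beta\longrightarrow\alpha)$; (2) $(\alpha\longrightarrow\beta)\longrightarrow((\alpha\longrightarrow(\beta\longrightarrow\gamma))\longrightarrow(\alpha\longrightarrow\gamma))$; (3) $\alpha\longrightarrow(\beta\longrightarrow(\alpha\land\beta))$; (4) $(\alpha\land\beta)\longrightarrow\alpha$; (5) $(\alpha\land\beta)\longrightarrow\beta$; (6) $\alpha\longrightarrow(\alpha\lor\beta)$; (7) $\beta\longrightarrow(\alpha\lor\beta)$; (8) $(\alpha\longrightarrow\gamma)\longrightarrow((\beta\longrightarrow\gamma)\longrightarrow((\alpha\lor\beta)\longrightarrow\gamma))$; (9) $\alpha\lor(\alpha\longrightarrow\beta)$; (10) $\alpha\longrightarrow(\neg\alpha\longrightarrow\beta)$; (11) $(\alpha\lor\neg\alpha)\lor\bigstar\alpha$; and the single inference rule modus ponens (from $\alpha$ and $\alpha\longrightarrow\beta$ infer $\beta$). For $\Gamma\cup\{\varphi\}\subseteq\mathcal{L}$, $\Gamma\vdash\varphi$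 means there is a finite sequence of formulas ending in $\varphi$, each of which is an axiom instance, an element of $\Gamma$, or obtained from two earlier members by modus ponens. An $\mathbf{mb}^\bigstar$-valuation is a function $v:\mathcal{L}\to\{0,1\}$ such that for all $\alpha,\beta\in\mathcal{L}$: (i) $v(\alpha\lor\beta)=1$ iff $v(\alpha)=1$ or $v(\beta)=1$; (ii) $v(\alpha\land\beta)=1$ iff $v(\alpha)=1$ and $v(\beta)=1$; (iii) $v(\alpha\longrightarrow\beta)=1$ iff $v(\alpha)=0$ or $v(\beta)=1$; (iv) if $v(\alpha)=1$ then $v(\neg\alpha)=0$; (v) if $v(\alpha)=0=v(\neg\alpha)$ then $v(\bigstar\alpha)=1$. $\Gamma\models\varphi$ means that for every $\mathbf{mb}^\bigstar$-valuation $v$, $v(\varphi)=1$ whenever $v(\gamma)=1$ for every $\gamma\in\Gamma$. *)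

(* Defs.v *)
From Stdlib Require Export List Ensembles FinFun.
Export ListNotations.
Set Implicit Arguments.

Definition denumerable (V : Type) : Prop := exists f : nat -> V, Bijective f.

Inductive formula (V : Type) : Type :=
| Var (p : V)
| And (a b : formula V)
| Or (a b : formula V)
| Imp (a b : formula V)
| Neg (a : formula V)
| Star (a : formula V).

Declare Scope formula_scope.
Delimit Scope formula_scope with F.
Bind Scope formula_scope with formula.
Notation "a /\ b" := (And a b) : formula_scope.
Notation "a \/ b" := (Or a b) : formula_scope.
Notation "a --> b" := (Imp a b)
  (at level 90, right associativity) : formula_scope.
Notation "~ a" := (Neg a) : formula_scope.
Notation "★ a" := (Star a) (at level 75, right associativity) : formula_scope.

Inductive is_axiom (V : Type) : formula V -> Prop :=
| ax1 a b : is_axiom (a --> (b --> a))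
| ax2 a b c : is_axiom ((a --> b) --> ((a --> (b --> c)) --> (a --> c)))
| ax3 a b : is_axiom (a --> (b --> (a /\ b)))
| ax4 a b : is_axiom ((a /\ b) --> a)
| ax5 a b : is_axiom ((a /\ b) --> b)
| ax6 a b : is_axiom (a --> (a \/ b))
| ax7 a b : is_axiom (b --> (a \/ b))
| ax8 a b c : is_axiom ((a --> c) --> ((b --> c) --> ((a \/ b) --> c)))
| ax9 a b : is_axiom (a \/ (a --> b))
| ax10 a b : is_axiom (a --> (~ a --> b))
| ax11 a : is_axiom ((a \/ ~ a) \/ ★ a).

Definition is_derivation (V : Type) (Gamma : Ensemble (formula V))
    (s : list (formula V)) : Prop :=
  forall (i : nat) (a : formula V), nth_error s i = Some a ->
    is_axiom a
    \/ In _ Gamma a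
    \/ exists (j k : nat) (b : formula V),
         j < i /\ k < i
         /\ nth_error s j = Some b /\ nth_error s k = Some (b --> a)%F.

Definition derives (V : Type) (Gamma : Ensemble (formula V))
    (phi : formula V) : Prop :=
  exists s : list (formula V), is_derivation Gamma (s ++ [phi]).

Record is_valuation (V : Type) (v : formula V -> bool) : Prop := {
  val_or : forall a b, v (a \/ b)%F = true <-> v a = true \/ v b = true;
  val_and : forall a b, v (a /\ b)%F = true <-> v a = true /\ v b = true;
  val_imp : forall a b, v (a --> b)%F = true <-> v a = false \/ v b = true;
  val_neg : forall a, v a = true -> v (~ a)%F = false;
  val_star : forall a, v a = false -> v (~ a)%F = false -> v (★ a)%F = true
}.

Definition entails (V : Type) (Gamma : Ensemble (formula V))
    (phi : formula V) : Prop :=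
  forall v : formula V -> bool, is_valuation v ->
    (forall gamma, In _ Gamma gamma -> v gamma = true) -> v phi = true.

(* Main.v *)
Require Import Defs.
From Stdlib Require Import Bool Arith.

(** Soundness: every axiom takes the value true under every valuation ([axiom_valid]), and modus
    ponens preserves truth, so truth spreads along a derivation ([derivation_sound]). Writing the
    clauses for the binary connectives as boolean equations turns axiom checking into truth
    tables. *)

Lemma valuation_orb {V : Type} {v : formula V -> bool} (hv : is_valuation v)
    (a b : formula V) : v (a \/ b)%F = v a || v b.
Proof. apply eq_true_iff_eq. rewrite orb_true_iff. apply (val_or hv). Qed.

Lemma valuation_andb {V : Type} {v : formula V -> bool} (hv : is_valuation v)
    (a b : formula V) : v (a /\ b)%F = v a && v b.
Proof. apply eq_true_iff_eq. rewrite andb_true_iff. apply (val_and hv). Qed.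

Lemma valuation_implb {V : Type} {v : formula V -> bool} (hv : is_valuation v)
    (a b : formula V) : v (a --> b)%F = implb (v a) (v b).
Proof.
  apply eq_true_iff_eq. rewrite implb_true_iff, (val_imp hv).
  destruct (v a), (v b); intuition congruence.
Qed.

Lemma axiom_valid {V : Type} {v : formula V -> bool} (hv : is_valuation v)
    {a : formula V} : is_axiom a -> v a = true.
Proof.
  intros [x y|x y z|x y|x y|x y|x y|x y|x y z|x y|x y|x];
    rewrite ?valuation_orb, ?valuation_implb, ?valuation_orb, ?valuation_andb,
      ?valuation_implb by exact hv;
    try solve [repeat match goal with |- context [v ?t] => destruct (v t) end;
      reflexivity].
  (* Only [ax10] and [ax11] remain: [v (~ x)] and [v (★ x)] are not functions of [v x], so a bare
     truth table fails and [val_neg] and [val_star] must exclude the bad rows. *)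
  - destruct (v x) eqn:hx; [rewrite (val_neg hv x hx)|]; reflexivity.
  - destruct (v x) eqn:hx; [reflexivity|].
    destruct (v (~ x)%F) eqn:hn; [reflexivity|].
    exact (val_star hv x hx hn).
Qed.

(** Covering all positions permits strong induction: the premises of modus ponens may lie anywhere
    earlier. *)
Lemma derivation_sound {V : Type} {Gamma : Ensemble (formula V)}
    {s : list (formula V)} {v : formula V -> bool} :
  is_derivation Gamma s -> is_valuation v ->
  (forall gamma, In _ Gamma gamma -> v gamma = true) ->
  forall (i : nat) (a : formula V), nth_error s i = Some a -> v a = true.
Proof.
  intros hs hv hG i.
  induction i as [i IH] using lt_wf_ind; intros a ha.
  destruct (hs i a ha) as [hax|[hin|(j & k & b & hj & hk & hb & hba)]].
  - exact (axiom_valid hv hax).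
  - exact (hG a hin).
  - assert (hi := IH k hk _ hba).
    rewrite (valuation_implb hv), (IH j hj b hb) in hi. exact hi.
Qed.

Theorem theorem2p14 (V : Type) (hV : denumerable V)
    (Gamma : Ensemble (formula V)) (phi : formula V) :
  derives Gamma phi -> entails Gamma phi.
Proof.
  intros [s hs] v hv hG.
  (* Counting from 0, [phi] has index [length s] in [s ++ [phi]]. *)
  apply (derivation_sound hs hv hG (length s)).
  rewrite nth_error_app2, Nat.sub_diag; reflexivity.
Qed.
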